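(* Let $G$ be a graph with vertex set $\{1,2,\ldots,n\}$ and let $r,k\ge1$ be integers such that $r\cdot k$ is even. (1) If $r=1$ and $k$ is even, then $G$ is optimally $(1,k)$-extendable if and only if $G$ contains a $\frac k2$-matching. (2) If $k=r$ is even, then $G$ is optimally $(k,k)$-extendable if and only if $G$ contains (at least) $\frac k2$ edges. (3) If $k-r\ge1$ is odd, then $G$ is optimally $(r,k)$-extendable if $G$ contains $r$ disjoint $\left(\frac{k-r+1}{2}\right)$-matchings. (4) If $k-r\ge1$ is even, then $G$ is optimally $(r,k)$-extendable if $G$ contains $r$ disjoint matchings, each of size $\frac12(k-r)+1$. (5) Suppose $d_G(i)\ge k$ for all $1\le i\le n$. If $k$ is even, then $G$ is optimally $(1,k)$-extendable, and if $k$ is odd, then $G$ is optimally $(2,k)$-extendable.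
   Context: Graphs are finite, simple and undirected, with $n\ge1$ vertices. $E(G)$ is the edge set of $G$, and $d_G(v)$ is the number of vertices adjacent to $v$ in $G$. Extension: for integers $r,k\ge1$ and a graph $G$ with vertex set $\{1,\ldots,n\}$, an $(r,k)$-extension of $G$ is a graph $H$ with vertex set $\{1,\ldots,n+r\}$ such that $d_H(i)=d_G(i)$ for $1\le i\le n$ and $d_H(n+j)=k$ for $1\le j\le r$. ($H$ is not required to contain $G$ as a subgraph.) $G$ is $(r,k)$-extendable if it has an $(r,k)$-extension. Edit number: if $G$ is not $(r,k)$-extendable, set $N_{r,k}(G)=\infty$. Otherwise $$N_{r,k}(G)=\min_H \#\big((E(G)\setminus E_1(H))\cup(E_1(H)\setminus E(G))\big),$$ where the minimum is over all $(r,k)$-extensions $H$ of $G$, and $E_1(H)\subseteq E(H)$ is the set of edges of $H$ with at least one endvertex in $\{1,\ldots,n\}$. Optimally extendable: $G$ is optimally $(r,k)$-extendable if $N_{r,k}(G)=\frac32 r(k-r+1)$. Matchings: an $l$-matching (matching of size $l$) of $G$ is a set of $l$ pairwise vertex-disjoint edges of $G$. Two matchings are disjoint if they have no edge in common (they may share vertices); ''$r$ disjoint matchings'' means pairwise disjoint in this sense. *)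

(* Defs.v *)
From HB Require Import structures.
From mathcomp Require Import all_boot all_order all_algebra.
Set Implicit Arguments.
Unset Strict Implicit.
Unset Printing Implicit Defensive.

(* A finite simple graph on T, given by its edge set: a set of 2-element
   subsets of T. *)
Record graph (T : finType) := Graph {
  edges : {set {set T}};
  edgesP : [forall e in edges, #|e| == 2]
}.

HB.instance Definition _ (T : finType) := [isSub for @edges T].
HB.instance Definition _ (T : finType) := [Finite of graph T by <:].

Definition adjacent (T : finType) (G : graph T) (u v : T) : bool :=
  [set u; v] \in edges G.

Definition degree (T : finType) (G : graph T) (v : T) : nat :=
  #|[set u | adjacent G v u]|.

(* The vertices 1, ..., n are [lshift r i] for i : 'I_n, and the added vertices
   n + 1, ..., n + r are [rshift n j] for j : 'I_r. *)
Definition is_extension (n r k : nat) (G : graph 'I_n) (H : graph 'I_(n + r))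
  : bool :=
  [forall i : 'I_n, degree H (lshift r i) == degree G i] &&
  [forall j : 'I_r, degree H (rshift n j) == k].

Definition extendable (n r k : nat) (G : graph 'I_n) : bool :=
  [exists H : graph 'I_(n + r), is_extension k G H].

(* E(G), transported along {1, ..., n} \subset {1, ..., n + r} *)
Definition lift_edges (n r : nat) (G : graph 'I_n) : {set {set 'I_(n + r)}} :=
  [set lshift r @: (e : {set 'I_n}) | e in edges G].

(* E_1(H) *)
Definition old_edges (n r : nat) (H : graph 'I_(n + r))
  : {set {set 'I_(n + r)}} :=
  [set e in edges H | [exists i : 'I_n, lshift r i \in e]].

Definition edit_cost (n r : nat) (G : graph 'I_n) (H : graph 'I_(n + r)) : nat :=
  #|(lift_edges r G :\: old_edges H) :|: (old_edges H :\: lift_edges r G)|.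

(* N_{r,k}(G), with None standing for infinity. The extension H0 found by pick
   only serves as the default value that arg min requires. *)
Definition edit_number (n r k : nat) (G : graph 'I_n) : option nat :=
  if [pick H : graph 'I_(n + r) | is_extension k G H] is Some H0 then
    Some (edit_cost G [arg min_(H < H0 | is_extension k G H) edit_cost G H])
  else None.

Lemma edit_number_None (n r k : nat) (G : graph 'I_n) :
  edit_number r k G = None <-> ~~ extendable r k G.
Proof.
rewrite /edit_number; case: pickP => [H hH | hN]; split=> //.
  by case/existsP; exists H.
by move=> _; apply/existsP => -[H]; rewrite hN.
Qed.

Lemma edit_number_Some (n r k : nat) (G : graph 'I_n) (m : nat) :
  edit_number r k G = Some m <->
  (exists2 H : graph 'I_(n + r), is_extension k G H & edit_cost G H = m) /\
  (forall H : graph 'I_(n + r), is_extension k G H -> m <= edit_cost G H).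
Proof.
rewrite /edit_number; case: pickP => [H0 h0 | hN]; last first.
  by split=> // -[[H]]; rewrite hN.
case: arg_minnP => // H1 h1 min1; split.
  by case=> <-; split=> //; exists H1.
case=> -[H2 h2 <-] min2; congr Some; apply/eqP.
by rewrite eqn_leq min1 // min2.
Qed.

(* The target value is computed in rat, so neither the division by 2 nor the
   subtraction is truncated. *)
Definition optimally_extendable (n r k : nat) (G : graph 'I_n) : Prop :=
  exists2 m : nat, edit_number r k G = Some m
    & (m%:R = 3 / 2 * r%:R * (k%:R - r%:R + 1) :> rat)%R.

Definition is_matching (T : finType) (G : graph T) (l : nat)
    (M : {set {set T}}) : bool :=
  [&& M \subset edges G, trivIset M & #|M| == l].

Definition has_matching (T : finType) (G : graph T) (l : nat) : Prop :=
  exists M : {set {set T}}, is_matching G l M.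

(* Disjoint means having no common edge: M i and M j may share vertices. *)
Definition has_disjoint_matchings (T : finType) (G : graph T) (r l : nat)
  : Prop :=
  exists M : 'I_r -> {set {set T}},
    (forall i, is_matching G l (M i)) /\
    (forall i j, i != j -> [disjoint M i & M j]).

(* Main.v *)
Require Import Defs.
From mathcomp Require Import all_boot all_order all_algebra.
From mathcomp Require Import zify ring lra.

(** Put l = k + 1 - r >= 0. Each added vertex has at least l old neighbours, so an
    extension has B >= r l edges between old and added vertices. Since old
    degrees are preserved, an extension which inserts x new edges between old
    vertices deletes x + B/2 edges of G, and therefore costs
    2x + 3B/2 >= 3 r l / 2. Equality forces x = 0 and B = r l: the deleted edges
    then form a set F of r l / 2 edges of G with maximum degree at most r.
    Conversely, such an F gives the optimal extension G - F plus a clique on the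
    added vertices plus a bipartite graph with old degrees d_F(i) and added
    degrees l, obtained by dealing out the endpoints of F cyclically. All five
    parts reduce to the existence of F. *)

Set Implicit Arguments.
Unset Strict Implicit.
Unset Printing Implicit Defensive.

Import GRing.Theory Num.Theory.

(** * Edge sets as plain sets of pairs: incidences, matchings, unions *)

Section EdgeSets.
Variable T : finType.
Implicit Types (E F M : {set {set T}}) (G : graph T) (u v : T).

Definition two_uniform E := forall e, e \in E -> #|e| = 2.

(** The degree of [v] for a bare edge set, so that subsets of E(G), matchings and symmetric
    differences of edge sets need not be packed as graphs. *)
Definition incidence E v := #|[set e in E | v \in e]|.

Lemma edges_two_uniform G : two_uniform (edges G).
Proof. by move=> e eG; apply/eqP; exact: (forall_inP (edgesP G)). Qed.

Lemma two_uniform_sub E F : F \subset E -> two_uniform E -> two_uniform F.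
Proof. by move=> /subsetP sFE hE e /sFE /hE. Qed.

Lemma two_uniform_neq E u v : two_uniform E -> [set u; v] \in E -> u != v.
Proof. by move=> hE /hE; rewrite cards2; case: (u != v). Qed.

Lemma incidence_sum E v : incidence E v = \sum_(e in E) (v \in e).
Proof.
rewrite /incidence -sum1_card [RHS]big_mkcond /= big_mkcond /=.
by apply: eq_bigr => e _; rewrite inE; case: (e \in E); case: (v \in e).
Qed.

Lemma incidence_subset E F v : F \subset E -> incidence F v <= incidence E v.
Proof.
move=> /subsetP sFE; apply: subset_leq_card; apply/subsetP => e.
by rewrite !inE => /andP[/sFE -> ->].
Qed.

Lemma incidence_le_card E v : incidence E v <= #|E|.
Proof. by apply: subset_leq_card; apply/subsetP => e; rewrite inE => /andP[]. Qed.

Lemma card_neighbours E v :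
  two_uniform E -> #|[set u | [set v; u] \in E]| = incidence E v.
Proof.
move=> hE; rewrite /incidence.
have -> : [set e in E | v \in e] = (fun u => [set v; u]) @: [set u | [set v; u] \in E].
  apply/setP => e; rewrite inE; apply/andP/imsetP => [[eE ve]|[u]].
    have /eqP/cards2P[x [y [_ De]]] := hE e eE.
    move: ve; rewrite De !inE => /orP[] /eqP Dv; subst v.
      by exists y; rewrite // inE -De.
    by exists x; rewrite ?inE setUC // -De.
  by rewrite inE => uE ->; split=> //; rewrite !inE eqxx.
rewrite card_in_imset // => x y; rewrite !inE => xE yE /setP/(_ y).
rewrite !inE eqxx orbT; have := two_uniform_neq hE yE; rewrite eq_sym => /negPf->.
by move=> /= /eqP.
Qed.

Lemma sum_neighbours E v :
  two_uniform E -> \sum_u ([set v; u] \in E) = incidence E v.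
Proof.
move=> hE; rewrite -card_neighbours // -sum1_card big_mkcond /= [RHS]big_mkcond.
by apply: eq_bigr => u _; rewrite inE; case: (_ \in E).
Qed.

Lemma handshake E : two_uniform E -> \sum_v incidence E v = #|E|.*2.
Proof.
move=> hE; under eq_bigr do rewrite incidence_sum.
rewrite exchange_big /= -muln2 -sum_nat_const; apply: eq_bigr => e eE.
rewrite -(hE e eE) -sum1_card [RHS]big_mkcond.
by apply: eq_bigr => v _; case: (_ \in e).
Qed.

Lemma degree_incidence G v : degree G v = incidence (edges G) v.
Proof. by rewrite -card_neighbours //; exact: edges_two_uniform. Qed.

Lemma degree_sum G v : degree G v = \sum_u adjacent G v u.
Proof. by rewrite degree_incidence -sum_neighbours //; exact: edges_two_uniform. Qed.

Lemma adjacentC G u v : adjacent G u v = adjacent G v u.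
Proof. by rewrite /adjacent setUC. Qed.

Lemma adjacent_irrefl G v : adjacent G v v = false.
Proof.
by apply/negP => /(two_uniform_neq (@edges_two_uniform G)); rewrite eqxx.
Qed.

(** Turns matchings into degree bounds, which add up under unions: [r] matchings together have
    maximum degree at most [r]. *)
Lemma trivIset_incidence M :
  trivIset M <-> forall v, incidence M v <= 1.
Proof.
split=> [/trivIsetP tM v|tM].
  apply/card_le1_eqP => e f; rewrite !inE => /andP[eM ve] /andP[fM vf].
  apply/eqP; apply: contraT => ef.
  by have /pred0P/(_ v) := tM f e fM eM ef; rewrite /= ve vf.
apply/trivIsetP => e f eM fM; apply: contraR => /pred0Pn[v /andP[ve vf]].
have /card_le1_eqP h := tM v.
by apply/eqP; apply: h; rewrite inE ?eM ?fM.
Qed.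

Lemma incidence_bigcup (I : finType) (M : I -> {set {set T}}) v :
  incidence (\bigcup_i M i) v <= \sum_i incidence (M i) v.
Proof.
rewrite /incidence.
have -> : [set e in \bigcup_i M i | v \in e] = \bigcup_i [set e in M i | v \in e].
  apply/setP => e; rewrite inE; apply/andP/bigcupP => [[/bigcupP[i _ ei] ve]|[i _]].
    by exists i; rewrite // inE ei.
  by rewrite inE => /andP[ei ->]; split=> //; apply/bigcupP; exists i.
elim/big_rec2: _ => [|i m A _ IH]; first by rewrite cards0.
by apply: leq_trans (leq_card_setU _ _) _; rewrite leq_add2l.
Qed.

Lemma subset_of_card (A : finType) (X : {set A}) m :
  m <= #|X| -> exists2 Y : {set A}, Y \subset X & #|Y| = m.
Proof.
case/card_geqP => s [us <- sX]; exists [set x in s].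
  by apply/subsetP => x; rewrite inE => /sX.
by rewrite cardsE; exact/card_uniqP.
Qed.

Lemma card_bigcup_disjoint (I A : finType) (M : I -> {set A}) :
  (forall i j, i != j -> [disjoint M i & M j]) ->
  #|\bigcup_i M i| = \sum_i #|M i|.
Proof.
move=> dM; rewrite -sum1_card partition_disjoint_bigcup //.
by apply: eq_bigr => i _; rewrite sum1_card.
Qed.

(** The clause [x != y] makes this a legitimate edge set for every [R]; adjacency is [R] itself once
    [R] is symmetric and irreflexive. *)
Definition rel_edges (R : rel T) : {set {set T}} :=
  [set e | [exists x, exists y, [&& x != y, R x y & e == [set x; y]]]].

Lemma rel_edgesP (R : rel T) : [forall e in rel_edges R, #|e| == 2].
Proof.
apply/forall_inP => e; rewrite inE => /existsP[x /existsP[y /and3P[xy _ /eqP->]]].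
by rewrite cards2 xy.
Qed.

Definition rel_graph (R : rel T) := Graph (rel_edgesP R).

Lemma adjacent_rel_graph (R : rel T) :
  symmetric R -> irreflexive R -> adjacent (rel_graph R) =2 R.
Proof.
move=> sR iR u v; rewrite /adjacent inE; apply/existsP/idP => [|uv]; last first.
  exists u; apply/existsP; exists v; rewrite uv eqxx !andbT.
  by apply: contraTneq uv => ->; rewrite iR.
case=> x /existsP[y /and3P[xy Rxy /eqP/setP h]].
have := h y; have := h x; rewrite !inE !eqxx !orbT.
move=> /orP[] /eqP Dx /orP[] /eqP Dy; move: xy Rxy; rewrite Dx Dy ?eqxx //.
by rewrite sR.
Qed.

End EdgeSets.

(** * Cyclic dealing and bipartite graphs with prescribed degrees *)

Section Dealing.

(* Number of cards received by player [j] when [m] cards are dealt in turn to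
   [r] players. *)
Definition dealt (r m : nat) (j : 'I_r) := \sum_(p < m) (p %% r == j :> nat).
Arguments dealt : clear implicits.

Lemma dealtS r m j : dealt r m.+1 j = dealt r m j + (m %% r == j).
Proof. by rewrite /dealt big_ord_recr. Qed.

Lemma dealt_le r m m' j : m <= m' -> dealt r m j <= dealt r m' j.
Proof.
elim: m' => [|m' IH]; first by rewrite leqn0 => /eqP->.
rewrite leq_eqVlt => /orP[/eqP->//|]; rewrite ltnS => /IH le.
by rewrite dealtS (leq_trans le) // leq_addr.
Qed.

Lemma dealt_total r m : 0 < r -> \sum_j dealt r m j = m.
Proof.
move=> r0; rewrite exchange_big /= -[RHS]card_ord -sum1_card.
apply: eq_bigr => p _; have lt := ltn_pmod p r0.
rewrite (bigD1 (Ordinal lt)) //= eqxx big1 // => j /negPf.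
by rewrite -val_eqE /= eq_sym => ->.
Qed.

Lemma dealt_round r m j : dealt r (m + r) j = (dealt r m j).+1.
Proof.
elim: m => [|m IH]; last by rewrite addSn !dealtS IH modnDr addSn.
rewrite add0n /dealt big_ord0 (bigD1 j) //= modn_small // eqxx big1 // => p /negPf.
by rewrite -val_eqE modn_small //= => ->.
Qed.

Lemma dealt_rounds r l j : dealt r (r * l) j = l.
Proof.
elim: l => [|l IH]; first by rewrite muln0 /dealt big_ord0.
by rewrite mulnS addnC dealt_round IH.
Qed.

(* A special case of the Gale-Ryser theorem: deal the copies of each [i]
   consecutively; as [d i <= r], nobody receives [i] twice. *)
Lemma bipartite_regular n r l (d : 'I_n -> nat) :
  0 < r -> (forall i, d i <= r) -> \sum_i d i = r * l ->
  exists b : 'I_n -> 'I_r -> bool,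
    (forall i, \sum_j b i j = d i) /\ (forall j, \sum_i b i j = l).
Proof.
move=> r0 dr sd.
(* [D m] cards are dealt before the block of vertex [m]; [N m j] below is the hand of [j] at that
   moment. *)
pose D m := \sum_(i < n | i < m) d i.
have D0 : D 0 = 0 by rewrite /D big_pred0.
have Dn : D n = r * l by rewrite -sd; apply: eq_bigl => i; rewrite ltn_ord.
have DS (i : 'I_n) : D i.+1 = D i + d i.
  rewrite /D (bigD1 i) //= addnC; congr (_ + _); apply: eq_bigl => x.
  by rewrite ltnS [RHS]ltn_neqAle andbC.
pose N i j := dealt r (D i) j.
(* A full round of [r] cards adds exactly one to each hand, and the block of [i] has [d i <= r]
   cards. *)
have NS (i : 'I_n) j : N i j <= N i.+1 j <= (N i j).+1.
  by rewrite /N DS -dealt_round !dealt_le ?leq_addr ?leq_add2l.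
(* Join [i] to [j] when [j] receives a card from the block of [i]. *)
exists (fun i j => N i j < N i.+1 j).
have bE (i : 'I_n) j : (N i j < N i.+1 j) = N i.+1 j - N i j :> nat.
  by have := NS i j; lia.
split=> [i|j]; under eq_bigr do rewrite bE.
  rewrite sumnB; last by move=> j _; case/andP: (NS i j).
  by rewrite !dealt_total // DS addKn.
(* The sum telescopes to the final hand of [j], which is [l] after [l] full rounds. *)
have -> : \sum_(i < n) (N i.+1 j - N i j) = \sum_(0 <= i < n) (N i.+1 j - N i j).
  by rewrite big_mkord.
rewrite (@telescope_sumn_in 0 n (N ^~ j)) //; last first.
  by move=> i /= lt; case/andP: (NS (Ordinal lt) j).
by rewrite /N Dn D0 dealt_rounds /dealt big_ord0 subn0.
Qed.

End Dealing.

(** * The edit cost as a degree sum, and its lower bound *)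

Section EditCost.
Variables (n r : nat) (G : graph 'I_n) (H : graph 'I_(n + r)).
Implicit Types (i : 'I_n) (j : 'I_r).

Lemma mem_lift_edges i i' :
  ([set lshift r i; lshift r i'] \in lift_edges r G) = adjacent G i i'.
Proof.
have -> : [set lshift r i; lshift r i'] = lshift r @: [set i; i'].
  by rewrite imsetU1 imset_set1.
by rewrite mem_imset //; exact/imset_inj/lshift_inj.
Qed.

Lemma rshift_lift_edges j (e : {set 'I_(n + r)}) : rshift n j \in e -> e \notin lift_edges r G.
Proof.
move=> je; apply/imsetP => -[f _ De]; move: je; rewrite De => /imsetP[i _ /eqP].
by rewrite eq_rlshift.
Qed.

Lemma mem_old_edges i u : ([set lshift r i; u] \in old_edges H) = adjacent H (lshift r i) u.
Proof.
rewrite inE /adjacent andb_idr // => _.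
by apply/existsP; exists i; rewrite !inE eqxx.
Qed.

Lemma rshift_old_edges j j' : [set rshift n j; rshift n j'] \notin old_edges H.
Proof.
rewrite inE negb_and; apply/orP; right; apply/existsPn => i.
by rewrite !inE !eq_lrshift.
Qed.

Lemma edit_set_two_uniform :
  two_uniform ((lift_edges r G :\: old_edges H) :|: (old_edges H :\: lift_edges r G)).
Proof.
move=> e; rewrite in_setU !in_setD => /orP[] /andP[_].
  case/imsetP=> f fG ->; rewrite card_imset; first exact: edges_two_uniform fG.
  exact: lshift_inj.
by rewrite inE => /andP[eH _]; exact: edges_two_uniform eH.
Qed.

(** Handshake on the set of edited edges. Ordered pairs of old vertices already count each edge
    twice; a crossing edge of [H] is never in the lifted graph, so it is always edited, and it is
    seen once from each end. *)
Lemma double_edit_cost :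
  (edit_cost G H).*2 =
    \sum_i \sum_i' (adjacent G i i' (+) adjacent H (lshift r i) (lshift r i'))
    + (\sum_i \sum_j adjacent H (lshift r i) (rshift n j)).*2.
Proof.
rewrite /edit_cost -handshake; last exact: edit_set_two_uniform.
rewrite (eq_bigr _ (fun u _ => esym (sum_neighbours u edit_set_two_uniform))).
rewrite big_split_ord /= -addnn addnA; congr (_ + _).
  rewrite -big_split /=; apply: eq_bigr => i _; rewrite big_split_ord /=; congr (_ + _).
    apply: eq_bigr => i' _; rewrite in_setU !in_setD mem_lift_edges mem_old_edges.
    by case: (adjacent G _ _); case: (adjacent H _ _).
  apply: eq_bigr => j _; rewrite in_setU !in_setD mem_old_edges.
  rewrite (negPf (@rshift_lift_edges j _ _)) ?andbF //=.
  by rewrite !inE eqxx orbT.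
rewrite [RHS]exchange_big; apply: eq_bigr => j _.
rewrite big_split_ord /= [X in _ + X]big1 ?addn0 => [|j' _].
  apply: eq_bigr => i _; rewrite in_setU !in_setD setUC mem_old_edges.
  by rewrite (negPf (@rshift_lift_edges j _ _)) ?andbF // !inE eqxx orbT.
rewrite in_setU !in_setD (negPf (rshift_old_edges _ _)).
by rewrite (negPf (@rshift_lift_edges j _ _)) ?andbF // !inE eqxx.
Qed.

Lemma is_extensionP k :
  reflect ((forall i, degree G i = \sum_i' adjacent H (lshift r i) (lshift r i')
                        + \sum_j adjacent H (lshift r i) (rshift n j)) /\
           (forall j, k = \sum_i adjacent H (lshift r i) (rshift n j)
                        + \sum_j' adjacent H (rshift n j) (rshift n j')))
          (is_extension k G H).
Proof.
have dl i : degree H (lshift r i) = \sum_i' adjacent H (lshift r i) (lshift r i')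
     + \sum_j adjacent H (lshift r i) (rshift n j).
  by rewrite degree_sum big_split_ord.
have dr j : degree H (rshift n j) = \sum_i adjacent H (lshift r i) (rshift n j)
     + \sum_j' adjacent H (rshift n j) (rshift n j').
  rewrite degree_sum big_split_ord /=; congr (_ + _).
  by apply: eq_bigr => i _; rewrite adjacentC.
apply: (iffP andP) => -[h1 h2]; split.
- by move=> i; rewrite -dl; apply/esym/eqP; exact: (forallP h1).
- by move=> j; rewrite -dr; apply/esym/eqP; exact: (forallP h2).
- by apply/forallP => i; rewrite dl -h1.
- by apply/forallP => j; rewrite dr -h2.
Qed.

(* The old-to-new edges of an extension make up for half as many deleted
   edges; each further inserted old edge costs two operations. *)
Lemma double_edit_cost_extension k : is_extension k G H ->
  (edit_cost G H).*2 =
    3 * (\sum_i \sum_j adjacent H (lshift r i) (rshift n j))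
    + 2 * \sum_i \sum_i'
        (adjacent H (lshift r i) (lshift r i') && ~~ adjacent G i i').
Proof.
case/is_extensionP=> hG _; rewrite double_edit_cost.
set S := (X in X + _); set B := (X in X.*2); set X := (X in _ * _ + 2 * X).
set h := \sum_i \sum_i' adjacent H (lshift r i) (lshift r i').
have e1 : \sum_i degree G i = h + B by rewrite /h /B -big_split; apply: eq_bigr.
(* Termwise: for truth values, [(a (+) b) + b = a + 2 (b && ~~ a)]. With [e1] this gives
   [S = B + 2X]. *)
have e2 : S + h = \sum_i degree G i + X.*2.
  rewrite -mul2n /S /h /X big_distrr -!big_split; apply: eq_bigr => i _ /=.
  rewrite degree_sum big_distrr -!big_split; apply: eq_bigr => i' _ /=.
  by case: (adjacent G _ _); case: (adjacent H _ _).
by lia.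
Qed.

Lemma new_degree_le j : \sum_j' adjacent H (rshift n j) (rshift n j') <= r.-1.
Proof.
apply: (@leq_trans (\sum_(j' | j' != j) 1)).
  rewrite [X in _ <= X]big_mkcond; apply: leq_sum => j' _.
  by have [->|_] := eqVneq j' j; [rewrite adjacent_irrefl | case: (adjacent _ _ _)].
by rewrite sum1_card cardC1 card_ord.
Qed.

Lemma crossing_edges_ge k : is_extension k G H -> r <= k.+1 ->
  r * (k.+1 - r) <= \sum_i \sum_j adjacent H (lshift r i) (rshift n j).
Proof.
case/is_extensionP=> _ hk rk; rewrite exchange_big /=.
rewrite -[X in X * _]card_ord -sum_nat_const; apply: leq_sum => j _ /=.
rewrite leq_subLR (hk j) -addnS addnC leq_add2r.
by rewrite -[X in _ <= X](ltn_predK (ltn_ord j)) ltnS new_degree_le.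
Qed.

End EditCost.

(** * Optimal extensions and edge sets of bounded degree *)

Section Optimality.
Variables (n r k : nat) (G : graph 'I_n).
Implicit Types (F : {set {set 'I_n}}).

(** Doubling clears the fraction, and [r <= k.+1] keeps the natural subtraction from truncating. *)
Lemma optimal_valueE m : r <= k.+1 ->
  (m%:R = 3 / 2 * r%:R * (k%:R - r%:R + 1) :> rat)%R <-> m.*2 = 3 * (r * (k.+1 - r)).
Proof.
move=> rk.
have <- : ((k.+1 - r)%:R = k%:R - r%:R + 1 :> rat)%R.
  by rewrite natrB // -natr1; ring.
split=> e.
  by apply/eqP; rewrite -(eqr_nat rat) -muln2 !natrM e; apply/eqP; field.
have : (m.*2%:R = (3 * (r * (k.+1 - r)))%:R :> rat)%R by rewrite e.
by rewrite -muln2 !natrM => ?; lra.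
Qed.

Lemma double_edit_cost_ge (H : graph 'I_(n + r)) : r <= k.+1 ->
  is_extension k G H -> 3 * (r * (k.+1 - r)) <= (edit_cost G H).*2.
Proof.
move=> rk hH; rewrite (double_edit_cost_extension hH).
by apply: leq_trans (leq_addr _ _); rewrite leq_mul2l (crossing_edges_ge hH rk).
Qed.

(** The target value bounds the cost of every extension from below, so an extension attaining it is
    automatically a minimum. *)
Lemma optimally_extendableE : r <= k.+1 ->
  optimally_extendable r k G <->
  exists2 H : graph 'I_(n + r), is_extension k G H
    & (edit_cost G H).*2 = 3 * (r * (k.+1 - r)).
Proof.
move=> rk; split=> [[m /edit_number_Some[[H hH <-] _] /(optimal_valueE _ rk) e]|].
  by exists H.
case=> H hH e; exists (edit_cost G H); last exact/optimal_valueE.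
apply/edit_number_Some; split=> [|H' hH']; first by exists H.
by rewrite -leq_double e double_edit_cost_ge.
Qed.

Lemma optimal_of_edges F : 0 < r -> r <= k.+1 ->
  F \subset edges G -> #|F|.*2 = r * (k.+1 - r) ->
  (forall i, incidence F i <= r) -> optimally_extendable r k G.
Proof.
move=> r0 rk sF cF dF; have uF := two_uniform_sub sF (@edges_two_uniform _ G).
have [b [b1 b2]] := bipartite_regular r0 dF (etrans (handshake uF) cF).
(* Old-old: [G] minus [F]; old-new: the bipartite graph [b]; new-new: a clique. *)
pose R (u v : 'I_(n + r)) := match split u, split v with
  | inl i, inl i' => adjacent G i i' && ([set i; i'] \notin F)
  | inl i, inr j => b i j
  | inr j, inl i => b i j
  | inr j, inr j' => j != j' end.
have sR : symmetric R.
  move=> u v; rewrite /R; case: (split u) => x; case: (split v) => y //.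
    by rewrite adjacentC setUC.
  by rewrite eq_sym.
have iR : irreflexive R.
  by move=> u; rewrite /R; case: (split u) => x; rewrite ?adjacent_irrefl ?eqxx.
have Rll i i' : R (lshift r i) (lshift r i') = adjacent G i i' && ([set i; i'] \notin F).
  by rewrite /R !(unsplitK (inl _)).
have Rlr i j : R (lshift r i) (rshift n j) = b i j.
  by rewrite /R (unsplitK (inl _)) (unsplitK (inr _)).
have Rrr j j' : R (rshift n j) (rshift n j') = (j != j').
  by rewrite /R !(unsplitK (inr _)).
have aR := adjacent_rel_graph sR iR.
apply/optimally_extendableE => //; exists (rel_graph R).
  apply/is_extensionP; split=> [i|j].
    under [X in _ = _ + X]eq_bigr do rewrite aR Rlr.
    under [X in _ = X + _]eq_bigr do rewrite aR Rll.
    rewrite b1 -sum_neighbours // degree_sum -big_split; apply: eq_bigr => i' _ /=.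
    have := subsetP sF [set i; i']; rewrite -/(adjacent _ _ _).
    by case: (adjacent _ _ _); case: (_ \in F) => // /(_ isT).
  under [X in _ = _ + X]eq_bigr do rewrite aR Rrr.
  under [X in _ = X + _]eq_bigr do rewrite aR Rlr.
  (* An added vertex has [k + 1 - r] old neighbours and [r - 1] clique neighbours, [k] in all. *)
  rewrite b2 (eq_bigr (fun j' => if j' != j then 1 else 0)); last first.
    by move=> j' _; rewrite eq_sym; case: (_ != _).
  by rewrite -big_mkcond sum1_card cardC1 card_ord; lia.
rewrite double_edit_cost.
(* Old pairs differ exactly on [F], whose degree sum is [#|F|.*2]. *)
have -> : \sum_i \sum_i' (adjacent G i i' (+) adjacent (rel_graph R) (lshift r i) (lshift r i'))
    = r * (k.+1 - r).
  rewrite -cF -handshake //; apply: eq_bigr => i _; rewrite -sum_neighbours //.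
  apply: eq_bigr => i' _; rewrite aR Rll.
  have := subsetP sF [set i; i']; rewrite -/(adjacent _ _ _).
  by case: (adjacent _ _ _); case: (_ \in F) => // /(_ isT).
under eq_bigr => i _ do under eq_bigr => j _ do rewrite aR Rlr.
under eq_bigr => i _ do rewrite b1.
by rewrite handshake // cF; lia.
Qed.

Lemma edges_of_optimal : r <= k.+1 -> optimally_extendable r k G ->
  exists F, [/\ F \subset edges G, #|F|.*2 = r * (k.+1 - r)
              & forall i, incidence F i <= r].
Proof.
move=> rk /(optimally_extendableE rk)[H hH cH].
have := crossing_edges_ge hH rk; have := double_edit_cost_extension hH.
rewrite cH; set B := \sum_i _; set X := \sum_i _ => eB geB.
have {eB geB} [BE /eqP] : B = r * (k.+1 - r) /\ X = 0 by lia.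
rewrite sum_nat_eq0 => /forallP X0.
have {X0}HG i i' : adjacent H (lshift r i) (lshift r i') -> adjacent G i i'.
  by have := X0 i; rewrite sum_nat_eq0 => /forallP/(_ i') /=; do 2 case: adjacent.
have [hG _] := is_extensionP _ _ _ hH.
pose F := [set e in edges G | lshift r @: (e : {set 'I_n}) \notin edges H].
have sF : F \subset edges G by apply/subsetP => e; rewrite inE => /andP[].
have uF := two_uniform_sub sF (@edges_two_uniform _ G).
(* No old edge is inserted, so degree preservation replaces each deleted edge at [i] by a crossing
   edge; there are at most [r] of these. *)
have iF i : incidence F i = \sum_j adjacent H (lshift r i) (rshift n j).
  apply/eqP; rewrite -(eqn_add2l (\sum_i' adjacent H (lshift r i) (lshift r i'))).
  rewrite -hG degree_sum -sum_neighbours // -big_split; apply/eqP.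
  apply: eq_bigr => i' _ /=; rewrite inE imsetU1 imset_set1.
  have := HG i i'; rewrite /adjacent.
  by case: (_ \in edges H); case: (_ \in edges G) => // /(_ isT).
exists F; split=> //; first by rewrite -handshake // -BE; apply: eq_bigr.
move=> i; rewrite iF -[X in _ <= X]card_ord -sum1_card.
by apply: leq_sum => j _; case: adjacent.
Qed.

(** Surplus edges can be discarded without raising any degree; the parity condition makes the
    required size an integer. *)
Lemma optimal_of_many_edges F : 0 < r -> r <= k.+1 ->
  ~~ odd (r * (k.+1 - r)) ->
  F \subset edges G -> r * (k.+1 - r) <= #|F|.*2 ->
  (forall i, incidence F i <= r) -> optimally_extendable r k G.
Proof.
move=> r0 rk ev sF cF dF.
have [|F' sF' cF'] := @subset_of_card _ F (r * (k.+1 - r))./2.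
  by rewrite -[X in _ <= X]doubleK half_leq.
apply: (@optimal_of_edges F') => //; first exact: subset_trans sF.
  by rewrite cF' even_halfK.
by move=> i; apply: leq_trans (dF i); exact: incidence_subset.
Qed.

Lemma optimal_of_matchings l : 0 < r -> r <= k.+1 ->
  ~~ odd (r * (k.+1 - r)) -> k.+1 - r <= l.*2 ->
  has_disjoint_matchings G r l -> optimally_extendable r k G.
Proof.
move=> r0 rk ev le [M [hM dM]].
apply: (@optimal_of_many_edges (\bigcup_i M i)) => //.
- by apply/bigcupsP => i _; case/and3P: (hM i).
- rewrite card_bigcup_disjoint // (eq_bigr (fun=> l)) => [|i _].
    by rewrite sum_nat_const card_ord -muln2 -mulnA muln2 leq_mul2l le orbT.
  by case/and3P: (hM i) => _ _ /eqP.
- move=> v; apply: leq_trans (incidence_bigcup _ _) _.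
  rewrite -[X in _ <= X]card_ord -sum1_card; apply: leq_sum => i _.
  by case/and3P: (hM i) => _ /trivIset_incidence.
Qed.

(* Greedy: while [#|F|.*2 < r * (k.+1 - r)], at most [k - r] vertices are
   saturated, so an unsaturated vertex has an unsaturated [G]-neighbour that is
   not already its [F]-neighbour. *)
Lemma greedy_edges m : 0 < n -> (forall i, k <= degree G i) ->
  m.*2 <= r * (k.+1 - r) ->
  exists F, [/\ F \subset edges G, #|F| = m & forall i, incidence F i <= r].
Proof.
move=> n0 dG; elim: m => [_|m IH lt].
  exists set0; split; rewrite ?sub0set ?cards0 // => i.
  by apply: leq_trans (incidence_le_card _ _) _; rewrite cards0.
have [|F [sF cF dF]] := IH; first by lia.
have uG := @edges_two_uniform _ G; have uF := two_uniform_sub sF uG.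
have r0 : 0 < r by rewrite lt0n; apply: contraTneq lt => ->.
pose S := [set i | incidence F i == r].
(* Each saturated vertex contributes [r] to the degree sum of [F], which is still below
   [r * (k.+1 - r)]. *)
have cS : #|S| < k.+1 - r.
  have : r * #|S| <= #|F|.*2.
    rewrite -handshake // mulnC -sum_nat_const big_mkcond; apply: leq_sum => i _.
    by rewrite inE; case: eqP => // ->.
  by rewrite -(ltn_pmul2l r0); lia.
(* Otherwise [n = #|S| < k + 1 - r <= k], although a vertex of degree at least [k] forces
   [k <= n]. *)
have [v vS] : exists v, v \notin S.
  apply/existsP; rewrite -negb_forall; apply/negP => /forallP ST.
  have SE : S = setT by apply/setP => i; rewrite in_setT ST.
  have := leq_trans (dG (Ordinal n0)) (max_card _); move: cS.
  by rewrite SE cardsT; lia.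
have dv : incidence F v < r by move: vS; rewrite inE ltn_neqAle dF andbT.
pose N := [set u | [set v; u] \in F].
have cN : #|N| < r by rewrite card_neighbours.
(* [S] and [N] together have at most [(k - r) + (r - 1) < k] elements, fewer than the neighbours of
   [v]. *)
have [u] : exists u, u \in [set u | adjacent G v u] :\: (S :|: N).
  apply/set0Pn; rewrite -subset0; apply/negP; rewrite subset0 => /eqP e0.
  have : [set u | adjacent G v u] \subset S :|: N by rewrite -setD_eq0 e0.
  move=> /subset_leq_card /leq_trans /(_ (leq_card_setU _ _)).
  by have := dG v; rewrite /degree; lia.
rewrite !inE negb_or => /andP[/andP[uS uN] vu].
exists ([set v; u] |: F); split.
- by rewrite subUset sub1set sF andbT.
- by rewrite cardsU1 uN cF.
move=> i; rewrite incidence_sum big_setU1 //= -incidence_sum !inE.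
have := dF i; rewrite leq_eqVlt => /orP[/eqP e|]; last by case: (_ || _) => /=; lia.
(* A saturated vertex is neither [u] nor [v], so its incidence does not grow. *)
have -> : (i == v) = false by apply: contraNF vS => /eqP<-; rewrite inE e.
by have -> : (i == u) = false; [apply: contraNF uS => /eqP<-; rewrite e | rewrite e].
Qed.

Lemma optimal_of_degrees : 0 < n -> 0 < r -> r <= k.+1 ->
  ~~ odd (r * (k.+1 - r)) -> (forall i, k <= degree G i) ->
  optimally_extendable r k G.
Proof.
move=> n0 r0 rk ev dG.
have [|F [sF cF dF]] := @greedy_edges (r * (k.+1 - r))./2 n0 dG.
  by rewrite even_halfK.
by apply: (@optimal_of_edges F); rewrite // cF even_halfK.
Qed.

End Optimality.

(** * The five criteria, read off from the existence of [F] *)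

Theorem corollary2 (n r k : nat) (G : graph 'I_n)
    (hn : 1 <= n) (hr : 1 <= r) (hk : 1 <= k) (hrk : ~~ odd (r * k)) :
  [/\ (r = 1 -> ~~ odd k ->
         (optimally_extendable 1 k G <-> has_matching G k./2)),
      (k = r -> ~~ odd k ->
         (optimally_extendable k k G <-> k./2 <= #|edges G|)),
      (1 <= k - r -> odd (k - r) ->
         has_disjoint_matchings G r (k - r + 1)./2 ->
         optimally_extendable r k G),
      (1 <= k - r -> ~~ odd (k - r) ->
         has_disjoint_matchings G r ((k - r)./2 + 1) ->
         optimally_extendable r k G)
    & ((forall i : 'I_n, k <= degree G i) ->
         (~~ odd k -> optimally_extendable 1 k G) /\
         (odd k -> optimally_extendable 2 k G))].
Proof.
split.
(* For [r = 1], [F] has maximum degree at most 1 and [k./2] edges: it is a matching. *)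
- move=> _ ek; split=> [/edges_of_optimal[]//|[F /and3P[sF /trivIset_incidence tF /eqP cF]]].
    move=> F [sF cF /trivIset_incidence tF]; exists F; rewrite /is_matching sF tF.
    by apply/eqP; lia.
  by apply: (optimal_of_edges _ _ sF) => //; lia.
(* For [r = k], [F] has [k./2] edges, so the degree bound [k] holds automatically. *)
- move=> _ ek; split=> [/edges_of_optimal[]//|cE].
    by move=> F [/subset_leq_card sF cF _]; move: cF; rewrite subSnn; lia.
  have [F sF cF] := subset_of_card cE.
  apply: (optimal_of_edges _ _ sF) => //; first by rewrite subSnn; lia.
  by move=> i; apply: leq_trans (incidence_le_card _ _) _; lia.
- move=> kr okr; apply: optimal_of_matchings => //; rewrite ?oddM; lia.
(* Here [k + 1 - r] is odd and the matchings are rounded up. As [k] and [r] have equal parity and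
   [r * k] is even, [r] is even, and so is [r * (k + 1 - r)]. *)
- move=> kr ekr; apply: optimal_of_matchings => //; last by lia.
    by lia.
  by move: hrk; rewrite !oddM; lia.
- move=> dG; split=> ek; apply: optimal_of_degrees => //; rewrite ?oddM; lia.
Qed.
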